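(* As formal power series in $q$ (equivalently for $|q|<1$), $$1+\sum_{n\ge 1}\mathit{pa}_o(n)q^n=\prod_{k\ge 1}\frac{1+q^k-q^{2k}}{1-q^{2k}}.$$
   Context: A partition of a positive integer $n$ is a weakly decreasing sequence of positive integers with sum $n$. An unlimited parity alternating partition is a partition whose different parts alternate in parity: if the distinct part sizes are $d_1>d_2>\cdots>d_r$, then $d_i$ and $d_{i+1}$ have different parities for every $i$ (parts may be repeated). $\mathit{pa}_o(n)$ is the number of unlimited parity alternating partitions of $n$ whose smallest part is odd. *)

(* Defs.v *)
From HB Require Import structures.
From mathcomp Require Import all_boot all_order all_algebra.
Set Implicit Arguments.
Unset Strict Implicit.
Unset Printing Implicit Defensive.
Import Order.TTheory GRing.Theory Num.Theory.

Definition is_partition (n : nat) (s : seq nat) : bool :=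
  [&& sorted geq s, all (leq 1) s & sumn s == n].

(* On a weakly decreasing s, undup s lists the distinct parts d_1 > ... > d_r. *)
Definition parity_alternating (s : seq nat) : bool :=
  sorted (fun a b => odd a != odd b) (undup s).

(* The smallest part of a nonempty weakly decreasing s is its last entry. *)
Definition smallest_part (s : seq nat) : nat := last 0%N s.

Definition is_pao (n : nat) (s : seq nat) : bool :=
  [&& is_partition n s, parity_alternating s & odd (smallest_part s)].

(* A partition of n has at most n parts, each at most n, so it is enough to
   count among the sequences of length <= n over 'I_n.+1; see mem_pao. *)
Definition pao (n : nat) : nat :=
  #|[set s : n.-bseq 'I_n.+1 | is_pao n (map val s)]|.

Local Open Scope ring_scope.

(* Z[[q]], a series being given by its coefficients. *)
Definition fps := nat -> int.

Definition fps_of_poly (p : {poly int}) : fps := fun n => p`_n.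

Definition fps_one : fps := fun n => (n == 0)%N%:R.

Definition fps_add (a b : fps) : fps := fun n => a n + b n.

Definition fps_mul (a b : fps) : fps :=
  fun n => \sum_(i < n.+1) a i * b (n - i)%N.

(* The first n coefficients of the inverse of a. *)
Fixpoint inv_coefs (a : fps) (n : nat) : seq int :=
  if n is m.+1 then
    let s := inv_coefs a m in
    rcons s (if m == 0%N then (a 0%N)^-1
             else - (a 0%N)^-1 * \sum_(1 <= i < m.+1) a i * s`_(m - i)%N)
  else [::].

(* The multiplicative inverse of a when a 0 is invertible; see fps_mulV. *)
Definition fps_inv (a : fps) : fps := fun n => (inv_coefs a n.+1)`_n.

Definition fps_div (a b : fps) : fps := fps_mul a (fps_inv b).

(* \prod_(k >= 1) F k = P: every coefficient of the partial products is
   eventually constant, equal to that of P. *)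
Definition fps_infprod (F : nat -> fps) (P : fps) : Prop :=
  forall n : nat, exists K : nat, forall N : nat, (K <= N)%N ->
    (\big[fps_mul/fps_one]_(1 <= k < N.+1) F k) n = P n.

Definition pao_series : fps := fun n => if (1 <= n)%N then (pao n)%:R else 0.

Lemma mem_pao (n : nat) (s : seq nat) :
  is_pao n s -> exists t : n.-bseq 'I_n.+1, map val t = s.
Proof.
case/and3P=> /and3P[_ pos_s /eqP sum_s] _ _.
have size_s : (size s <= n)%N.
  rewrite -{n}sum_s; elim: s pos_s => //= x s IHs /andP[x_gt0 /IHs le_s].
  by rewrite -add1n leq_add.
have le_s : all (ltn^~ n.+1) s.
  apply/allP=> x s_x; rewrite /= ltnS -sum_s; elim: {pos_s sum_s size_s}s s_x => //=.
  move=> y s IHs; rewrite inE => /predU1P[->|/IHs le_x]; first exact: leq_addr.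
  exact: leq_trans le_x (leq_addl _ _).
have sz : (size (map (@inord n) s) <= n)%N by rewrite size_map.
exists (Bseq sz) => /=; rewrite -map_comp -[RHS]map_id.
by apply/eq_in_map=> x s_x /=; rewrite inordK //; apply: (allP le_s).
Qed.

Lemma size_inv_coefs a n : size (inv_coefs a n) = n.
Proof. by elim: n => //= n IHn; rewrite size_rcons IHn. Qed.

Lemma nth_inv_coefs a n i : (i < n)%N -> (inv_coefs a n)`_i = fps_inv a i.
Proof.
elim: n => // n IHn; rewrite ltnS leq_eqVlt => /predU1P[-> //|lt_in].
by rewrite /= nth_rcons size_inv_coefs lt_in IHn.
Qed.

Lemma fps_mulV a n :
  a 0%N \is a GRing.unit -> fps_mul a (fps_inv a) n = fps_one n.
Proof.
move=> a0; rewrite /fps_mul /fps_one big_ord_recl subn0 /=.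
rewrite {1}/fps_inv /= nth_rcons size_inv_coefs ltnn eqxx.
case: n => [|n] /=; first by rewrite big_ord0 addr0 divrr.
rewrite mulrA mulrN divrr // mulN1r big_add1 big_mkord addrC; apply/eqP.
rewrite subr_eq0; apply/eqP/eq_bigr => i _; congr (_ * _).
rewrite -/(inv_coefs a n.+1) nth_inv_coefs //.
by rewrite subSS ltnS leq_subr.
Qed.

(* Main.v *)
(** The [k]-th factor is [1 + q^k / (1 - q^(2k)) = 1 + q^k + q^(3k) + ...], so
    the coefficient of [q^n] in the product counts the finitely supported
    sequences [g_1, g_2, ...] with every [g_k] zero or odd and
    [\sum_k k g_k = n].  Reading [g_k] as the gap between the [k]-th and
    [k+1]-st parts of a partition of [n] (absent parts being [0]), these are
    the partitions whose successive distinct parts, the final [0] included,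
    have odd differences: the parities alternate and the smallest part is odd. *)
Require Import Defs.
From mathcomp Require Import all_boot all_order all_algebra.
From mathcomp Require Import zify.
Set Implicit Arguments.
Unset Strict Implicit.
Unset Printing Implicit Defensive.
Import GRing.Theory.

(** * Partitions encoded by their gaps *)

Definition zero_or_odd (g : nat) : bool := (g == 0) || odd g.

(** The parts are the suffix sums of the gaps; stopping at the first zero sum drops the absent
    parts. *)
Fixpoint parts_of_gaps (gs : seq nat) : seq nat :=
  if gs is g :: gs' then
    if g + sumn gs' == 0 then [::] else (g + sumn gs') :: parts_of_gaps gs'
  else [::].

(* The first [N] gaps, padded with zeros when [s] has fewer than [N] parts. *)
Fixpoint gaps_of_parts (N : nat) (s : seq nat) : seq nat :=
  if N is M.+1 then
    (head 0 s - head 0 (behead s)) :: gaps_of_parts M (behead s)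
  else [::].

(** The default in [head 0 s'] makes the last part itself the final gap. *)
Fixpoint gaps_zero_or_odd (s : seq nat) : bool :=
  if s is x :: s' then zero_or_odd (x - head 0 s') && gaps_zero_or_odd s'
  else true.

Fixpoint weight (ks gs : seq nat) : nat :=
  match ks, gs with
  | k :: ks', g :: gs' => k * g + weight ks' gs'
  | _, _ => 0
  end.

Definition gap_multiples (k n : nat) : seq nat :=
  [seq i <- iota 0 n.+1 | (k %| i) && zero_or_odd (i %/ k)].
Arguments gap_multiples : simpl never.

(** Enumerated by the multiple [i = k * g] rather than by the gap [g], so that the recursion mirrors
    the convolution in [fps_mul]. *)
Fixpoint gap_seqs (ks : seq nat) (n : nat) : seq (seq nat) :=
  if ks is k :: ks' then
    [seq (i %/ k) :: gs | i <- gap_multiples k n, gs <- gap_seqs ks' (n - i)]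
  else if n == 0 then [:: [::]] else [::].

Lemma head_parts_of_gaps gs : head 0 (parts_of_gaps gs) = sumn gs.
Proof. by case: gs => //= g gs; case: eqP. Qed.

Lemma gaps_of_nil N : gaps_of_parts N [::] = nseq N 0.
Proof. by elim: N => //= N ->. Qed.

Lemma sumn_eq0_nseq gs : sumn gs = 0 -> gs = nseq (size gs) 0.
Proof.
elim: gs => //= g gs IHgs /eqP; rewrite addn_eq0 => /andP[/eqP -> /eqP /IHgs].
by move=> {1}->.
Qed.

Lemma parts_of_gapsK gs : gaps_of_parts (size gs) (parts_of_gaps gs) = gs.
Proof.
elim: gs => //= g gs IHgs; case: eqP => [sum0|_] /=.
  (* A zero suffix sum means that all remaining gaps vanish, and the padding restores exactly
     these. *)
  rewrite gaps_of_nil.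
  by rewrite [RHS](@sumn_eq0_nseq (g :: gs)).
by rewrite head_parts_of_gaps addnK IHgs.
Qed.

Lemma sorted_geq_cons x s :
  sorted geq (x :: s) = (head 0 s <= x) && sorted geq s.
Proof. by case: s => //=; rewrite leq0n. Qed.

(** The gaps telescope, truncated subtraction being exact on a weakly decreasing sequence. *)
Lemma sumn_gaps_of_parts N s :
  sorted geq s -> size s <= N -> sumn (gaps_of_parts N s) = head 0 s.
Proof.
elim: N s => [|N IHN] [|x s] //; first by rewrite gaps_of_nil sumn_nseq mul0n.
rewrite sorted_geq_cons => /andP[le_x sort_s] size_s /=.
by rewrite IHN // subnK.
Qed.

Lemma gaps_of_partsK N s :
    sorted geq s -> all (leq 1) s -> size s <= N ->
  parts_of_gaps (gaps_of_parts N s) = s.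
Proof.
elim: N s => [|N IHN] [|x s] //.
  by rewrite gaps_of_nil /= sumn_nseq.
rewrite sorted_geq_cons => /andP[le_x sort_s] /= /andP[x_gt0 pos_s] size_s.
by rewrite sumn_gaps_of_parts // subnK // IHN // eqn0Ngt x_gt0.
Qed.

Lemma size_gaps_of_parts N s : size (gaps_of_parts N s) = N.
Proof. by elim: N s => //= N IHN s; rewrite IHN. Qed.

Lemma gaps_zero_or_odd_parts gs :
  all zero_or_odd gs -> gaps_zero_or_odd (parts_of_gaps gs).
Proof.
elim: gs => //= g gs IHgs /andP[ok_g /IHgs ok_gs]; case: eqP => //= _.
by rewrite head_parts_of_gaps addnK ok_g.
Qed.

Lemma all_gaps_of_parts N s :
  gaps_zero_or_odd s -> all zero_or_odd (gaps_of_parts N s).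
Proof.
by elim: N s => //= N IHN [|x s] /=; [rewrite IHN | case/andP=> -> /IHN].
Qed.

Lemma sorted_parts_of_gaps gs : sorted geq (parts_of_gaps gs).
Proof.
elim: gs => //= g gs IHgs; case: eqP => // _.
by rewrite sorted_geq_cons head_parts_of_gaps leq_addl.
Qed.

Lemma parts_of_gaps_gt0 gs : all (leq 1) (parts_of_gaps gs).
Proof. by elim: gs => //= g gs IHgs; case: eqP => //= /eqP; rewrite lt0n => ->. Qed.

Lemma weight_iotaS m N gs :
  size gs = N -> weight (iota m.+1 N) gs = weight (iota m N) gs + sumn gs.
Proof.
elim: N m gs => [|N IHN] m [|g gs] //= [size_gs].
by rewrite IHN // mulSn (addnC g) addnACA.
Qed.

Lemma weight_eq0 m gs : sumn gs = 0 -> weight (iota m (size gs)) gs = 0.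
Proof.
elim: gs m => //= g gs IHgs m /eqP; rewrite addn_eq0 => /andP[/eqP -> /eqP gs0].
by rewrite muln0 IHgs.
Qed.

(** The [k]-th gap occurs in the first [k] suffix sums. Inductively, a new first gap shifts the
    other indices by one, which adds [sumn gs]; together with [g] this is the new largest part. *)
Lemma sumn_parts_of_gaps gs :
  sumn (parts_of_gaps gs) = weight (iota 1 (size gs)) gs.
Proof.
elim: gs => //= g gs IHgs; case: eqP => [sum0|_] /=.
  by rewrite weight_eq0; lia.
by rewrite IHgs (@weight_iotaS 1) //; lia.
Qed.

(** * Enumeration of the gap sequences of given weight *)

Lemma mem_gap_seqs ks n gs : all (leq 1) ks ->
  (gs \in gap_seqs ks n) =
    [&& size gs == size ks, all zero_or_odd gs & weight ks gs == n].
Proof.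
elim: ks n gs => [|k ks IHks] n gs /=.
  by case: n gs => [|n] [|g gs].
case/andP=> k_gt0 pos_ks; apply/allpairsPdep/idP=> [[i [t [i_in t_in ->]]]|].
  move: i_in t_in; rewrite mem_filter mem_iota => /andP[/andP[/dvdnP[g ->] ok_g]].
  rewrite add0n ltnS => /andP[_ le_n]; rewrite IHks // => /and3P[size_t ok_t /eqP wt].
  rewrite mulnK // in ok_g *; rewrite /= eqSS size_t ok_g ok_t /= wt.
  by rewrite mulnC subnKC.
case: gs => [//|g gs] /=; rewrite eqSS.
case/and3P=> size_gs /andP[ok_g ok_gs] /eqP <-.
exists (k * g), gs; split; last by rewrite mulKn.
  by rewrite mem_filter mem_iota dvdn_mulr // mulKn // ok_g /= ltnS leq_addr.
by rewrite IHks // size_gs ok_gs addKn eqxx.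
Qed.

Lemma gap_seqs_uniq ks n : all (leq 1) ks -> uniq (gap_seqs ks n).
Proof.
elim: ks n => [|k ks IHks] n /=; first by case: ifP.
case/andP=> k_gt0 pos_ks; apply: allpairs_uniq_dep.
- by rewrite filter_uniq // iota_uniq.
- by move=> i _; apply: IHks.
move=> _ _ /allpairsPdep[i [s [i_in _ ->]]] /allpairsPdep[j [t [j_in _ ->]]] /=.
move: i_in j_in; rewrite !mem_filter => /andP[/andP[k_i _] _] /andP[/andP[k_j _] _].
by case=> eq_ij ->; rewrite -(divnK k_i) -(divnK k_j) eq_ij.
Qed.

Lemma size_partition n s : is_partition n s -> size s <= n.
Proof.
case/and3P=> _ pos_s /eqP <-; elim: s pos_s => //= x s IHs /andP[x_gt0 /IHs].
by rewrite -add1n; apply: leq_add.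
Qed.

Lemma iota1_gt0 N : all (leq 1) (iota 1 N).
Proof. by apply/allP=> k; rewrite mem_iota => /andP[]. Qed.

Lemma mem_parts_of_gap_seqs n N s : n <= N ->
  (s \in map parts_of_gaps (gap_seqs (iota 1 N) n)) =
    is_partition n s && gaps_zero_or_odd s.
Proof.
move=> le_nN; apply/mapP/idP=> [[gs]|/andP[part_s ok_s]].
  rewrite mem_gap_seqs ?iota1_gt0 // size_iota => /and3P[/eqP size_gs ok_gs wt] ->.
  rewrite gaps_zero_or_odd_parts // /is_partition sorted_parts_of_gaps.
  by rewrite parts_of_gaps_gt0 sumn_parts_of_gaps size_gs wt.
have size_s := leq_trans (size_partition part_s) le_nN.
case/and3P: part_s => sort_s pos_s sum_s.
exists (gaps_of_parts N s); last by rewrite gaps_of_partsK.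
rewrite mem_gap_seqs ?iota1_gt0 // size_gaps_of_parts size_iota eqxx.
rewrite all_gaps_of_parts //= -{1}(size_gaps_of_parts N s) -sumn_parts_of_gaps.
by rewrite gaps_of_partsK.
Qed.

(** Among gap sequences of the common length [N], the parts determine the gaps. *)
Lemma parts_of_gap_seqs_uniq n N :
  uniq (map parts_of_gaps (gap_seqs (iota 1 N) n)).
Proof.
rewrite map_inj_in_uniq ?gap_seqs_uniq ?iota1_gt0 // => s t.
rewrite !mem_gap_seqs ?iota1_gt0 // => /and3P[/eqP size_s _ _] /and3P[/eqP size_t _ _].
by move=> eq_st; rewrite -(parts_of_gapsK s) -(parts_of_gapsK t) size_s size_t eq_st.
Qed.

(** * The parity condition in terms of gaps *)

Lemma head_undup_geq x s : sorted geq (x :: s) -> head 0 (undup (x :: s)) = x.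
Proof.
elim: s x => // y s IHs x /[dup] sort_xys /= /andP[le_yx sort_ys].
case: ifP => //= x_in; have [->|neq_xy] := eqVneq x y; first exact: IHs.
have le_s : all (geq y) s by apply: order_path_min sort_ys => ? ? ? /= ? ?; lia.
move: x_in; rewrite inE (negPf neq_xy) /= => /(allP le_s) /= le_xy.
by case/eqP: neq_xy; apply/eqP; rewrite eqn_leq le_xy.
Qed.

(** A nonzero gap is odd exactly when the two distinct parts around it differ in parity; the final
    gap is the smallest part, which is positive. The empty sequence fails the right side only, its
    smallest part defaulting to [0]. *)
Lemma gaps_zero_or_oddE s : s != [::] -> sorted geq s -> all (leq 1) s ->
  gaps_zero_or_odd s = parity_alternating s && odd (smallest_part s).
Proof.
elim: s => // x [|y s] IHs _.
  by move=> _ /andP[x_gt0 _]; rewrite /= subn0 /zero_or_odd eqn0Ngt x_gt0 andbT.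
move=> /[dup] sort_xys /andP[le_yx sort_ys] /andP[x_gt0 pos_ys].
have /= -> := IHs isT sort_ys pos_ys.
rewrite /smallest_part /= andbA; congr (_ && _).
rewrite /parity_alternating; have -> : undup [:: x, y & s] =
  if x \in y :: s then undup (y :: s) else x :: undup (y :: s) by [].
have le_s : all (geq y) s by apply: order_path_min sort_ys => ? ? ? /= ? ?; lia.
have -> : (x \in y :: s) = (x == y).
  rewrite inE; case: eqVneq => //= neq_xy; apply/negP=> /(allP le_s) /= le_xy.
  by case/eqP: neq_xy; apply/eqP; rewrite eqn_leq le_xy.
have [->|neq_xy] := eqVneq x y; first by rewrite subnn.
(* The first distinct part after [x] is [y], so the new parity test compares [x] with [y]. *)
have := head_undup_geq sort_ys.
have : undup (y :: s) != [::] by rewrite -size_eq0 -lt0n -has_predT has_undup.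
case: (undup _) => //= z t _ ->.
rewrite /zero_or_odd subn_eq0 leqNgt ltn_neqAle eq_sym neq_xy (le_yx : y <= x) /=.
by rewrite oddB //; case: (odd x); case: (odd y).
Qed.

Lemma is_paoE n s : 0 < n -> is_pao n s = is_partition n s && gaps_zero_or_odd s.
Proof.
move=> n_gt0; rewrite /is_pao; have [part_s /=|//] := boolP (is_partition n s).
case/and3P: part_s => sort_s pos_s /eqP sum_s.
by rewrite gaps_zero_or_oddE //; case: (s) sum_s n_gt0 => //= <-.
Qed.

(** * Counting partitions by gap sequences *)

Lemma size_pao n (L : seq (seq nat)) : uniq L -> L =i is_pao n -> size L = pao n.
Proof.
move=> uniqL memL; rewrite /pao cardE.
rewrite -(size_map (fun t : n.-bseq 'I_n.+1 => map val t)).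
apply: perm_size; apply: uniq_perm => // [|s].
  rewrite map_inj_uniq ?enum_uniq // => s t /(inj_map val_inj); exact: val_inj.
rewrite memL; apply/idP/mapP=> [pao_s|[t]].
  have [t def_s] := mem_pao pao_s; exists t => //.
  by rewrite mem_enum inE def_s.
by rewrite mem_enum inE => pao_t ->.
Qed.

Lemma size_gap_seqs n N : n <= N ->
  size (gap_seqs (iota 1 N) n) = if 0 < n then pao n else 1.
Proof.
move=> le_nN; rewrite -(size_map parts_of_gaps); have uniqL := parts_of_gap_seqs_uniq n N.
have memL s := mem_parts_of_gap_seqs s le_nN.
case: posnP => [n0|n_gt0]; last first.
  by apply: size_pao => // s; rewrite memL -is_paoE.
(* For [n = 0] only the empty partition remains, which [is_pao] rejects; hence the separate value
   [1]. *)
apply: (@perm_size _ _ [:: [::]]); apply: uniq_perm => // s; rewrite memL n0 inE.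
by apply/idP/eqP=> [/andP[/size_partition]|-> //]; case: s.
Qed.

(** * Coefficients of the factors and of the partial products *)

Local Open Scope ring_scope.

Lemma fps_mulDl (p r : {poly int}) b n :
  fps_mul (fps_of_poly (p + r)) b n =
    fps_mul (fps_of_poly p) b n + fps_mul (fps_of_poly r) b n.
Proof.
by rewrite -big_split; apply: eq_bigr => i _; rewrite /fps_of_poly coefD mulrDl.
Qed.

Lemma fps_mulNl (p : {poly int}) b n :
  fps_mul (fps_of_poly (- p)) b n = - fps_mul (fps_of_poly p) b n.
Proof.
by rewrite -sumrN; apply: eq_bigr => i _; rewrite /fps_of_poly coefN mulNr.
Qed.

Lemma fps_mulXnl k b n :
  fps_mul (fps_of_poly 'X^k) b n = if (k <= n)%N then b (n - k)%N else 0.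
Proof.
rewrite /fps_mul /fps_of_poly; under eq_bigr do rewrite coefXn.
case: leqP => [le_kn|lt_nk].
  rewrite (bigD1 (Ordinal (le_kn : (k < n.+1)%N))) //= eqxx mul1r big1 ?addr0 //.
  by move=> i; rewrite -val_eqE /= => /negPf ->; rewrite mul0r.
rewrite big1 // => i _; have := ltn_ord i; case: eqP => [->|_ _]; last by rewrite mul0r.
by rewrite ltnS leqNgt lt_nk.
Qed.

Lemma fps_mul1l b n : fps_mul (fps_of_poly 1) b n = b n.
Proof. by rewrite -(expr0 'X) fps_mulXnl subn0. Qed.

(** Geometric series: the coefficients [b] of the inverse satisfy [b_n = [n = 0] + b_(n-m)], without
    the last term when [n < m]. *)
Lemma fps_inv_1subXn m n : (0 < m)%N ->
  fps_inv (fps_of_poly (1 - 'X^m)) n = (m %| n)%N%:R.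
Proof.
move=> m_gt0; elim/ltn_ind: n => n IHn.
have := @fps_mulV (fps_of_poly (1 - 'X^m)) n.
rewrite {1}/fps_of_poly coefB coef1 coefXn /= eq_sym -[m == 0%N]negbK -lt0n m_gt0.
rewrite subr0 unitr1 => /(_ isT).
rewrite fps_mulDl fps_mulNl fps_mul1l fps_mulXnl /fps_one => /eqP.
rewrite subr_eq => /eqP ->; case: leqP => [le_mn|lt_nm].
  have n_gt0 := leq_trans m_gt0 le_mn.
  rewrite IHn ?ltn_subrL ?m_gt0 // eqn0Ngt n_gt0 add0r.
  by rewrite dvdn_subl.
rewrite addr0; case: posnP => [->|n_gt0]; first by rewrite dvdn0.
by rewrite gtnNdvd.
Qed.

(** Both sides say that [n = (2j + 1)k] for some [j]; these are the exponents in
    [q^k / (1 - q^(2k))]. *)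
Lemma dvd2_sub_odd k n : (0 < k)%N ->
  ((k <= n) && (2 * k %| n - k))%N = ((k %| n) && odd (n %/ k))%N.
Proof.
move=> k_gt0; apply/andP/andP=> [[le_kn /dvdnP[j def_n]]|[/dvdnP[g ->]]].
  have -> : n = ((2 * j).+1 * k)%N by lia.
  by rewrite dvdn_mull // mulnK //= oddM.
rewrite mulnK // => odd_g; split; first by rewrite leq_pmull // odd_gt0.
have -> : (g * k - k = g.-1 * k)%N by rewrite -subn1 mulnBl mul1n.
by rewrite dvdn_pmul2r // dvdn2; case: g odd_g.
Qed.

Lemma factor_coef k n : (0 < k)%N ->
  fps_div (fps_of_poly (1 + 'X^k - 'X^(2 * k)%N))
          (fps_of_poly (1 - 'X^(2 * k)%N)) n
  = ((k %| n) && zero_or_odd (n %/ k))%N%:R.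
Proof.
move=> k_gt0; have k2_gt0 : (0 < 2 * k)%N by rewrite muln_gt0.
(* The numerator is regrouped as [(1 - X^(2k)) + X^k], whose first summand cancels the
   denominator. *)
rewrite /fps_div -addrA (addrC 'X^k) addrA fps_mulDl fps_mulV; last first.
  rewrite /fps_of_poly coefB coef1 coefXn /= eq_sym -[(_ == 0)%N]negbK -lt0n.
  by rewrite k2_gt0 subr0 unitr1.
rewrite fps_mulXnl fps_inv_1subXn // /fps_one.
have -> : (if (k <= n)%N then ((2 * k %| n - k)%N)%:R else 0) =
    ((k %| n) && odd (n %/ k))%N%:R :> int.
  by rewrite -dvd2_sub_odd //; case: leqP.
(* The constant term [1] accounts for the zero gap; for positive multiples of [k] the quotient is
   nonzero. *)
have [->|n_gt0] := posnP n; first by rewrite div0n andbF dvdn0 addr0.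
rewrite add0r; case: (boolP (k %| n)%N) => //= k_n.
by rewrite /zero_or_odd eqn0Ngt divn_gt0 // dvdn_leq.
Qed.

(** Each factor has coefficients [0] and [1], so convolving with it sums the counts for [n - i] over
    the [i] in its support, as [gap_seqs] does. *)
Lemma prod_coef ks n : all (leq 1) ks ->
  (\big[fps_mul/fps_one]_(k <- ks)
     fps_div (fps_of_poly (1 + 'X^k - 'X^(2 * k)%N))
             (fps_of_poly (1 - 'X^(2 * k)%N))) n = (size (gap_seqs ks n))%:R.
Proof.
elim: ks n => [|k ks IHks] n /=; first by rewrite big_nil /fps_one; case: eqP.
case/andP=> k_gt0 pos_ks; rewrite big_cons size_allpairs_dep sumnE big_map.
rewrite big_filter natr_sum -[n.+1]subn0 -/(index_iota 0 n.+1) big_mkcond big_mkord.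
apply: eq_bigr => i _; rewrite factor_coef // IHks //.
by case: ifP => _; rewrite ?mul1r ?mul0r.
Qed.

Theorem theorem4p4 :
  fps_infprod
    (fun k : nat => fps_div (fps_of_poly (1 + 'X^k - 'X^(2 * k)%N))
                            (fps_of_poly (1 - 'X^(2 * k)%N)))
    (fps_add fps_one pao_series).
Proof.
(* A partition of [n] has at most [n] parts, so the coefficient is stable from [N = n] on. *)
move=> n; exists n => N le_nN.
rewrite /index_iota subn1 prod_coef ?iota1_gt0 // size_gap_seqs //.
by rewrite /fps_add /fps_one /pao_series; case: n le_nN => *; rewrite ?add0r ?addr0.
Qed.
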